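(* Let $P$ be any source program (an $\mathsf{asm}$ program satisfying the standing requirements and hypotheses stated in the context), and let $\mathcal F(P)$ be its folding. If $P$, run in the source semantics, is observationally non-interfering under the weak observer mode $\mathit{obs}^-$, then $\mathcal F(P)$, run in the target semantics, is observationally non-interfering under the strong observer mode $\mathit{obs}^+$; that is, $$\mathit{obs}^-\text{-ONI}(P)\ \Longrightarrow\ \mathit{obs}^+\text{-ONI}(\mathcal F(P)).$$
   Context: **Instructions.** Values $v\in\mathbb V$, registers $x\in\mathbb R$, labels/locations $\ell\in\mathbb L$ (code addresses; each instruction occupies one address). Expressions $e$ are values or registers; $(\!|e|\!)_r$ is the value of $e$ in register map $r$. Common instructions: non-control-flow unary and binary operations $\mathtt{op}_1\,x\,e$ and $\mathtt{op}_2\,x\,e\,e'$ (including loads), $\mathtt{store}\,e\,e'$, $\mathtt{br}\,e\,\ell_t\,\ell_f$, $\mathtt{call}\,\ell$, $\mathtt{ret}$. Source programs may additionally use secret-dependent branches $\mathtt{s.br}\,e\,\ell_t\,\ell_f$ and secret-dependent calls $\mathtt{s.call}\,b\,\ell\,\ell'$ ($b\in\{\top,\bot\}$ immediate; the function at $\ell'$ is the dummy version of the function at $\ell$). Target programs may additionally use level-offset branches $\mathtt{lo.br}\,e\,\mathit{off}_t\,\mathit{off}_f\,\mathit{bbc}$ and level-offset calls $\mathtt{lo.call}\,b\,\ell$. A program $P$ is a partial map from locations to instructions. **Configurations.** Source: $\langle m,r,pc,\rho\rangle$ with memory $m:\mathbb V\to\mathbb V$, register map $r:\mathbb R\to\mathbb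 V$, program counter $pc$, stack $\rho$ of return addresses. Target: $\langle m,r,pc,\rho,\lambda\rangle$ where in addition $\lambda$ is a stack of Libra contexts $(\mathit{bbc},\mathit{off})$. Initial configurations have $pc$ at the program's entry point and empty return stack; an initial target configuration has context stack consisting of the single context $(1,0)$. **Semantics.** Non-control-transfer instructions $i$ act deterministically by a relation $\langle m,r\rangle \xrightarrow{i}\langle m',r'\rangle$. Source step (standard): non-control-transfer instructions update $(m,r)$ and set $pc'=pc+1$; $\mathtt{br}$ and $\mathtt{s.br}$ jump to $\ell_t$ if $(\!|e|\!)_r\ne 0$ and to $\ell_f$ otherwise; $\mathtt{call}\,\ell$ pushes $pc+1$ on $\rho$ and jumps to $\ell$; $\mathtt{s.call}\,b\,\ell\,\ell'$ pushes $pc+1$ and jumps to $\ell$ if $b=\top$, to $\ell'$ if $b=\bot$; $\mathtt{ret}$ pops $\rho$ and jumps to the popped address. Target step with context stack $\lambda\cdot(\mathit{bbc},\mathit{off})$: non-control-transfer instructions update $(m,r)$ and set $pc'=pc+\mathit{bbc}$; $\mathtt{br}$ jumps to its label, leaving the contexts unchanged; $\mathtt{lo.br}\,e\,\mathit{off}_t\,\mathit{off}_f\,\mathit{bbc}'$ sets $pc'=(pc-\mathit{off}+\mathit{bbc})+o$ and replaces the top context by $(\mathit{bbc}',o)$, where $o=\mathit{off}_t$ if $(\!|e|\!)_r\neq0$ and $o=\mathit{off}_f$ otherwise; $\mathtt{call}\,\ell$ pushes $pc+\mathit{bbc}$ on $\rho$, pushes context $(1,0)$, jumps to $\ell$; $\mathtt{lo.call}\,b\,\ell$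 pushes $pc+\mathit{bbc}$ on $\rho$, pushes context $(2,o)$ and jumps to $\ell+o$, where $o=0$ if $b=\top$ and $o=1$ if $b=\bot$; $\mathtt{ret}$ pops $\rho$, jumps to the popped address, and pops the top context. A step from configuration $\sigma$ emits the observation $\mathit{obs}(\sigma)$, where $\mathit{obs}$ is a parameter; $\sigma\overset{o}{\Rightarrow}{}^{n}\sigma'$ denotes $n$ steps with $o$ the concatenation of the emitted observations. **Leakage model.** $\mathscr L$ assigns to each instruction the identifier of its leakage class. The instruction set is partitioned into safe instructions (which expose no operand value) and unsafe ones (unary unsafe; binary left-unsafe, right-unsafe, left-right-unsafe), which expose the values of their only, left, right, or both source operands. The weak observation $\mathit{obs}^-$ of a configuration whose current instruction is $i$ (determined by $m,r,pc$) is $\mathscr L(i)$ if $i$ is safe, and $\mathscr L(i)$ followed by the value(s) of the exposed operand(s) if $i$ is unsafe. The strong observation, for target configurations, is $$\mathit{obs}^+(\langle m,r,pc,\rho,\lambda\cdot(\mathit{bbc},\mathit{off})\rangle)=(pc-\mathit{off})\cdot \mathit{obs}^-(\langle m,r,pc\rangle),$$ i.e. the address of the current slice together with the weak observation. Observations are non-cancelling: $o_1\cdot o_2=o_1'\cdot o_2'$ implies $o_1=o_1'$ and $o_2=o_2'$. The choice of $\mathscr L$ and of the safe/unsafe partition is free subject to the following assumptions: $\mathtt{s.br}$ and $\mathtt{lo.br}$ are safe (they do not leak their outcome); $\mathtt{s.call}$ and $\mathtt{lo.call}$ are safe (they do not reveal whether the original or the dummy function is actually executed); $\mathtt{br}\,e\,\ell_t\,\ell_f$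 is unsafe and leaks its outcome; $\mathtt{call}\,\ell$ is unsafe and leaks its target; and control-flow-altering instructions belong in a distinct leakage class from each other and from non-control-flow-altering instructions. **Security.** Registers and memory locations are partitioned into public and secret. $\sigma\simeq\sigma'$ iff the configurations agree on the values of public registers and public memory locations. A program is $\mathit{obs}$-ONI iff for all initial configurations $\sigma_0\simeq\sigma_0'$: if $\sigma_0\overset{o}{\Rightarrow}{}^{n}\sigma_n$, then $\sigma'_0\overset{o'}{\Rightarrow}{}^{n}\sigma'_n$ for some $\sigma_n',o'$ and $o=o'$. **CFG notions.** Programs consist of functions, each with a control-flow graph of basic blocks with unique entry and exit blocks; the last instruction of each block is a terminating instruction ($\mathtt{br}$, $\mathtt{s.br}$ or $\mathtt{ret}$; calls occur inside blocks), and labels point to beginnings of blocks. A block $Y$ postdominates $X$ if all paths from $X$ to the exit block go through $Y$; the immediate postdominator of $X$ is its closest postdominator (other than $X$). The secret-dependent region of an $\mathtt{s.br}$ is the set of blocks between the block containing it (the region's entry block) and the immediate postdominator of that block (the region's exit block). The level structure of a region (resp. function) partitions its blocks into levels $L_1,L_2,\dots$ (resp. $L_0,L_1,\dots$) by distance (number of edges of a shortest path) from the region's entry block (resp. the function's entry block). Blocks in a level are indexed from $0$. **Folding $\mathcal F$.** *Rewriting terminators* of level $L_i$ with respect to $L_{i+1}$: each terminator $\mathtt{br}\,e\,\ell_t\,\ell_f$ or $\mathtt{s.br}\,e\,\ell_t\,\ell_f$ becomes $\mathtt{lo.br}\,e\,\mathit{off}_t\,\mathit{off}_f\,|L_{i+1}|$,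 where $\mathit{off}_t,\mathit{off}_f$ are the indices in $L_{i+1}$ of the blocks at $\ell_t,\ell_f$; $\mathtt{ret}$ is unchanged. *Folding a level* $L=\{B_0,\dots,B_k\}$ of equally long blocks yields one block $B'$ with $B'[j\cdot|L|+i]=B_i[j]$; for each $j$, the $|L|$ consecutive instructions $B'[j|L|],\dots,B'[j|L|+|L|-1]$ form a slice of size $|L|$, the one coming from $B_i$ being at offset $i$. *Folding a region* with levels $L_1,\dots,L_n$: let $L_0$ be the singleton level of its entry block and $L_{n+1}$ that of its exit block; rewrite terminators and fold each of $L_0,\dots,L_n$. *Folding a function $F$ with its dummy $F'$*: take the componentwise union of the level structures of $F$ and $F'$ (entry block of $F$ at index $0$ and of $F'$ at index $1$ in level $0$), rewrite terminators and fold each level; the result gets a fresh entry label $\ell_{ff'}$. Then $\mathcal F(P)$ is obtained as follows: (1) for each function/dummy pair at $\ell_f,\ell_{f'}$ annotated by an $\mathtt{s.call}$, include the folded function at $\ell_{ff'}$, keeping the original functions too if they can be called by normal calls; (2) replace each outermost secret-dependent region by its folding; (3) copy all other blocks; (4) replace each $\mathtt{s.call}\,b\,\ell_f\,\ell_{f'}$ by $\mathtt{lo.call}\,b\,\ell_{ff'}$; (5) lay out the folded levels of a region or function adjacently in memory, in level order, the exit block of a region coming directly after its last folded level. Labels of remaining $\mathtt{br}$ and of $\mathtt{call}$ instructions are mapped to the corresponding (unfolded) target locations. Instructions outside folded blocks form slices of size $1$ (offset $0$). **Standing requirements/hypotheses on $P$.** (i) In a function, the terminating instruction of blocks in the last level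 is $\mathtt{ret}$; (ii) in a secret-dependent region or function (a function folded with its dummy), all blocks of a given level have the same number of instructions; (iii) in such a region or function, all successors of blocks in level $L_i$ are in level $L_{i+1}$ (the exit block counting as the level after the last level of a region); (iv) $P$ is safe: in particular, starting from an initial configuration, the source semantics does not get stuck; (v) functions are entered only through their entry point and always return to their return site; (vi) secret-dependent regions are single-entry single-exit: entered only through their entry block and always exited through their exit block.
   Formalization: The leakage class of s.call is required to determine its function/dummy pair (and that of lo.call its target), never b; with one class for all s.call the claim fails when two balanced secret branches call different pairs. *)

(* Defs.v *)
From mathcomp Require Import all_boot.
From Stdlib Require List.

Set Implicit Arguments.
Unset Strict Implicit.
Unset Printing Implicit Defensive.

(** * Instructions *)

Definition loc := nat.

Record isa := Isa {
  value : eqType;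
  vzero : value;
  reg : Type;
  op1 : Type;
  op2 : Type }.

Inductive expr (A : isa) := EVal of value A | EReg of reg A.

(* The instructions that do not alter control flow; loads are among the
   [Op1]/[Op2] operations. *)
Inductive basic (A : isa) :=
| Op1 of op1 A & reg A & expr A
| Op2 of op2 A & reg A & expr A & expr A
| Store of expr A & expr A.

Inductive sinstr (A : isa) :=
| SBasic of basic A
| SBr of expr A & loc & loc
| SCall of loc
| SRet
| SSecBr of expr A & loc & loc
| SSecCall of bool & loc & loc.

Inductive tinstr (A : isa) :=
| TBasic of basic A
| TBr of expr A & loc & loc
| TCall of loc
| TRet
| TLoBr of expr A & nat & nat & nat
| TLoCall of bool & loc.

Arguments SCall {A}. Arguments SRet {A}. Arguments SSecCall {A}.
Arguments TCall {A}. Arguments TRet {A}. Arguments TLoCall {A}.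

Definition mem (A : isa) := value A -> value A.
Definition regs (A : isa) := reg A -> value A.

Definition eval (A : isa) (r : regs A) (e : expr A) : value A :=
  match e with EVal v => v | EReg x => r x end.

Record machine := Machine {
  arch :> isa;
  exec : basic arch -> mem arch * regs arch -> mem arch * regs arch -> Prop;
  exec_det : forall i s s1 s2, exec i s s1 -> exec i s s2 -> s1 = s2;
  pub_reg : pred (reg arch);
  pub_mem : pred (value arch) }.

Definition low_eq (M : machine) (m : mem M) (r : regs M) (m' : mem M)
    (r' : regs M) : Prop :=
  (forall x, pub_reg x -> r x = r' x) /\ (forall a, pub_mem a -> m a = m' a).

(** * Semantics *)

Record sconf (A : isa) := SConf {
  s_mem : mem A; s_regs : regs A; s_pc : loc; s_ret : seq loc }.

(* Stacks have their top at the head; a Libra context is a pair (bbc, off). *)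
Record tconf (A : isa) := TConf {
  t_mem : mem A; t_regs : regs A; t_pc : loc; t_ret : seq loc;
  t_ctx : seq (nat * nat) }.

Inductive sstep (M : machine) (P : loc -> option (sinstr M)) :
    sconf M -> sconf M -> Prop :=
| sstep_basic m r pc rho i m' r' :
    P pc = Some (SBasic i) -> exec i (m, r) (m', r') ->
    sstep P (SConf m r pc rho) (SConf m' r' pc.+1 rho)
| sstep_br m r pc rho e lt lf :
    P pc = Some (SBr e lt lf) ->
    sstep P (SConf m r pc rho)
      (SConf m r (if eval r e != vzero M then lt else lf) rho)
| sstep_secbr m r pc rho e lt lf :
    P pc = Some (SSecBr e lt lf) ->
    sstep P (SConf m r pc rho)
      (SConf m r (if eval r e != vzero M then lt else lf) rho)
| sstep_call m r pc rho l :
    P pc = Some (SCall l) ->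
    sstep P (SConf m r pc rho) (SConf m r l (pc.+1 :: rho))
| sstep_seccall m r pc rho (b : bool) l l' :
    P pc = Some (SSecCall b l l') ->
    sstep P (SConf m r pc rho)
      (SConf m r (if b then l else l') (pc.+1 :: rho))
| sstep_ret m r pc a rho :
    P pc = Some SRet ->
    sstep P (SConf m r pc (a :: rho)) (SConf m r a rho).

Inductive tstep (M : machine) (Q : loc -> option (tinstr M)) :
    tconf M -> tconf M -> Prop :=
| tstep_basic m r pc rho bbc off lam i m' r' :
    Q pc = Some (TBasic i) -> exec i (m, r) (m', r') ->
    tstep Q (TConf m r pc rho ((bbc, off) :: lam))
      (TConf m' r' (pc + bbc) rho ((bbc, off) :: lam))
| tstep_br m r pc rho bbc off lam e lt lf :
    Q pc = Some (TBr e lt lf) ->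
    tstep Q (TConf m r pc rho ((bbc, off) :: lam))
      (TConf m r (if eval r e != vzero M then lt else lf) rho
         ((bbc, off) :: lam))
| tstep_lobr m r pc rho bbc off lam e offt offf bbc' o :
    Q pc = Some (TLoBr e offt offf bbc') ->
    o = (if eval r e != vzero M then offt else offf) ->
    tstep Q (TConf m r pc rho ((bbc, off) :: lam))
      (TConf m r (pc - off + bbc + o) rho ((bbc', o) :: lam))
| tstep_call m r pc rho bbc off lam l :
    Q pc = Some (TCall l) ->
    tstep Q (TConf m r pc rho ((bbc, off) :: lam))
      (TConf m r l (pc + bbc :: rho) [:: (1, 0), (bbc, off) & lam])
| tstep_locall m r pc rho bbc off lam (b : bool) l o :
    Q pc = Some (TLoCall b l) -> o = (if b then 0 else 1) ->
    tstep Q (TConf m r pc rho ((bbc, off) :: lam))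
      (TConf m r (l + o) (pc + bbc :: rho) [:: (2, o), (bbc, off) & lam])
| tstep_ret m r pc a rho bbc off lam :
    Q pc = Some TRet ->
    tstep Q (TConf m r pc (a :: rho) ((bbc, off) :: lam))
      (TConf m r a rho lam).

(* Traces keep one entry per step, and the components of an entry are paired
   rather than flattened into a word: this is what makes them
   non-cancelling (an associative concatenation cannot be, unless there is a
   single observation). *)
Inductive nsteps (C O : Type) (step : C -> C -> Prop) (obs : C -> O) :
    nat -> C -> seq O -> C -> Prop :=
| nsteps0 c : nsteps step obs 0 c [::] c
| nstepsS n c c1 o c2 :
    step c c1 -> nsteps step obs n c1 o c2 ->
    nsteps step obs n.+1 c (obs c :: o) c2.

Definition ONI (C O : Type) (step : C -> C -> Prop) (obs : C -> O)
    (init : C -> Prop) (low : C -> C -> Prop) : Prop :=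
  forall c0 c0', init c0 -> init c0' -> low c0 c0' ->
  forall n o cn, nsteps step obs n c0 o cn ->
  exists cn' o', nsteps step obs n c0' o' cn' /\ o = o'.

(** * Leakage model *)

(* The part of an instruction on which its leakage class may depend: the whole
   instruction if it does not alter control flow, and otherwise the mnemonic,
   together with the function/dummy pair for secret-dependent calls (resp. the
   folded function for level-offset calls). The immediate [b] of the latter
   is left out, so that the class does not tell the function from its dummy.
   The pair is included because which folded function is called is visible in
   the address of its slices: two balanced branches that call different pairs
   with indistinguishable bodies must not count as secure. *)
Inductive ikind (A : isa) :=
| KBasic of basic A
| KBr | KCall | KRet
| KSecBr | KSecCall of loc & loc
| KLoBr | KLoCall of loc.

Arguments KBr {A}. Arguments KCall {A}. Arguments KRet {A}.
Arguments KSecBr {A}. Arguments KSecCall {A}.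
Arguments KLoBr {A}. Arguments KLoCall {A}.

Definition alters_flow (A : isa) (k : ikind A) : bool :=
  if k is KBasic _ then false else true.

Definition skind (A : isa) (i : sinstr A) : ikind A :=
  match i with
  | SBasic b => KBasic b
  | SBr _ _ _ => KBr
  | SCall _ => KCall
  | SRet => KRet
  | SSecBr _ _ _ => KSecBr
  | SSecCall _ l l' => KSecCall l l'
  end.

Definition tkind (A : isa) (i : tinstr A) : ikind A :=
  match i with
  | TBasic b => KBasic b
  | TBr _ _ _ => KBr
  | TCall _ => KCall
  | TRet => KRet
  | TLoBr _ _ _ _ => KLoBr
  | TLoCall _ l => KLoCall l
  end.

(* [exposes i] tells whether the left (or only) and the right source operand
   of [i] are exposed; (false, false) is a safe instruction. What a branch
   exposes is [br_out] of its operand: this may be the operand itself or just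
   its truth value, as long as it determines the outcome. *)
Record leakage (A : isa) := Leakage {
  lclass : Type;
  lclass_of : ikind A -> lclass;
  exposes : basic A -> bool * bool;
  br_out : value A -> value A;
  lclass_of_flow : forall k k',
    alters_flow k -> lclass_of k = lclass_of k' -> k = k';
  br_out_outcome : forall v v',
    br_out v = br_out v' -> (v == vzero A) = (v' == vzero A) }.

Inductive atom (A : isa) := AVal of value A | ALoc of loc.
Arguments ALoc {A}.

Definition wobs (A : isa) (K : leakage A) := (lclass K * seq (atom A))%type.

Definition operands (A : isa) (i : basic A) : seq (expr A) :=
  match i with
  | Op1 _ _ e => [:: e]
  | Op2 _ _ e e' => [:: e; e']
  | Store e e' => [:: e; e']
  end.

Definition basic_atoms (A : isa) (K : leakage A) (r : regs A) (i : basic A) :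
    seq (atom A) :=
  mask [:: (exposes K i).1; (exposes K i).2]
       [seq AVal (eval r e) | e <- operands i].

Definition swobs (A : isa) (K : leakage A) (r : regs A) (i : sinstr A) :
    wobs K :=
  (lclass_of K (skind i),
   match i with
   | SBasic b => basic_atoms K r b
   | SBr e _ _ => [:: AVal (br_out K (eval r e))]
   | SCall l => [:: ALoc l]
   | SRet | SSecBr _ _ _ | SSecCall _ _ _ => [::]
   end).

Definition twobs (A : isa) (K : leakage A) (r : regs A) (i : tinstr A) :
    wobs K :=
  (lclass_of K (tkind i),
   match i with
   | TBasic b => basic_atoms K r b
   | TBr e _ _ => [:: AVal (br_out K (eval r e))]
   | TCall l => [:: ALoc l]
   | TRet | TLoBr _ _ _ _ | TLoCall _ _ => [::]
   end).

(* [None] for configurations without a current instruction (or context), from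
   which there is no step. *)
Definition sobs_weak (A : isa) (K : leakage A) (P : loc -> option (sinstr A))
    (c : sconf A) : option (wobs K) :=
  omap (swobs K (s_regs c)) (P (s_pc c)).

Definition tobs_strong (A : isa) (K : leakage A) (Q : loc -> option (tinstr A))
    (c : tconf A) : option (loc * wobs K) :=
  if t_ctx c is (bbc, off) :: _ then
    omap (fun i => (t_pc c - off, twobs K (t_regs c) i)) (Q (t_pc c))
  else None.

(** * Programs and control-flow graphs *)

Record func (A : isa) := Func {
  f_entry : loc;
  f_exit : loc;
  f_blocks : seq (loc * seq (sinstr A)) }.

Record sprog (A : isa) := SProg {
  s_funs : seq (func A);
  s_entry : loc }.

Record tprog (A : isa) := TProg {
  t_code : loc -> option (tinstr A);
  t_entry : loc }.

Definition labels (A : isa) (f : func A) : seq loc :=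
  [seq b.1 | b <- f_blocks f].

Definition blocks (A : isa) (P : sprog A) : seq (loc * seq (sinstr A)) :=
  flatten [seq f_blocks f | f <- s_funs P].

Definition code_at (I : Type) (b : loc * seq I) (l : loc) : option I :=
  if b.1 <= l then onth b.2 (l - b.1) else None.

Fixpoint fetch (I : Type) (bs : seq (loc * seq I)) (l : loc) : option I :=
  if bs is b :: bs' then
    if code_at b l is Some i then Some i else fetch bs' l
  else None.

Definition s_code (A : isa) (P : sprog A) : loc -> option (sinstr A) :=
  fetch (blocks P).

(* Blocks are designated by their labels from here on. *)
Definition body (A : isa) (P : sprog A) (l : loc) : seq (sinstr A) :=
  if ohead [seq b <- blocks P | b.1 == l] is Some b then b.2 else [::].

Definition is_term (A : isa) (i : sinstr A) : bool :=
  match i with SBr _ _ _ | SSecBr _ _ _ | SRet => true | _ => false end.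

Definition term (A : isa) (P : sprog A) (l : loc) : sinstr A :=
  last SRet (body P l).

Definition is_ret (A : isa) (i : sinstr A) : bool :=
  if i is SRet then true else false.

Definition is_secbr (A : isa) (i : sinstr A) : bool :=
  if i is SSecBr _ _ _ then true else false.

Definition succs (A : isa) (P : sprog A) (l : loc) : seq loc :=
  match term P l with
  | SBr _ lt lf | SSecBr _ lt lf => [:: lt; lf]
  | _ => [::]
  end.

Definition edge (A : isa) (P : sprog A) : rel loc :=
  fun l l' => l' \in succs P l.

Definition distance (A : isa) (P : sprog A) (x y : loc) (d : nat) : Prop :=
  (exists p, [/\ path (edge P) x p, last x p = y & size p = d]) /\
  (forall p, path (edge P) x p -> last x p = y -> d <= size p).

Definition postdominates (A : isa) (P : sprog A) (f : func A) (y x : loc) :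
    Prop :=
  y \in labels f /\
  forall p, path (edge P) x p -> last x p = f_exit f -> y \in x :: p.

Definition ipostdom (A : isa) (P : sprog A) (f : func A) (z x : loc) : Prop :=
  [/\ z <> x, postdominates P f z x
    & exists2 d, distance P x z d
      & forall y d', y <> x -> postdominates P f y x -> distance P x y d' ->
        d <= d'].

(* A secret-dependent region is given by its entry and exit blocks. *)
Definition sec_region (A : isa) (P : sprog A) (x z : loc) : Prop :=
  exists f, [/\ List.In f (s_funs P), x \in labels f, is_secbr (term P x)
              & ipostdom P f z x].

Definition in_region (A : isa) (P : sprog A) (x z b : loc) : Prop :=
  exists p q, path (edge P) x (p ++ b :: rcons q z) /\ z \notin p ++ b :: q.

(* Level 0 holds the entry block, as in the folding of a region. *)
Definition region_level (A : isa) (P : sprog A) (x z : loc) (i : nat)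
    (b : loc) : Prop :=
  if i is 0 then b = x else in_region P x z b /\ distance P x b i.

(* Blocks that cannot be reached from the entry block have no level. *)
Definition fun_level (A : isa) (P : sprog A) (f : loc) (i : nat) (b : loc) :
    Prop :=
  distance P f b i.

Definition seccall_pair (A : isa) (P : sprog A) (f f' : loc) : Prop :=
  exists l b, s_code P l = Some (SSecCall b f f').

Definition called (A : isa) (P : sprog A) (f : loc) : Prop :=
  exists l, s_code P l = Some (SCall f).

(** * Requirements on source programs *)

Definition wf_body (A : isa) (s : seq (sinstr A)) : Prop :=
  exists s' t, [/\ s = rcons s' t, is_term t & ~~ has (@is_term A) s'].

Definition is_entry (A : isa) (P : sprog A) (l : loc) : Prop :=
  exists2 f, List.In f (s_funs P) & f_entry f = l.

Record wf_cfg (A : isa) (P : sprog A) : Prop := WfCfg {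
  wf_disjoint : pairwise
    (fun b c => (b.1 + size b.2 <= c.1) || (c.1 + size c.2 <= b.1)) (blocks P);
  wf_blocks : forall b, List.In b (blocks P) -> wf_body b.2;
  wf_entry : forall f, List.In f (s_funs P) -> f_entry f \in labels f;
  wf_exit : forall f, List.In f (s_funs P) -> f_exit f \in labels f;
  wf_ret : forall f l, List.In f (s_funs P) -> l \in labels f ->
    (is_ret (term P l) <-> l = f_exit f);
  wf_succs : forall f l l', List.In f (s_funs P) -> l \in labels f ->
    edge P l l' -> l' \in labels f;
  wf_main : is_entry P (s_entry P) }.

(* Branches stay within their function by [wf_succs], and the stack discipline
   of the semantics makes every return go to its return site. *)
Definition entered_at_entry (A : isa) (P : sprog A) : Prop :=
  (forall f, called P f -> is_entry P f) /\
  (forall f f', seccall_pair P f f' -> is_entry P f /\ is_entry P f').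

(* A successor of level i is in level i+1; the exit block is the level after
   the last one, that is, level i+1 if there is no block of the region there. *)
Record region_ok (A : isa) (P : sprog A) (x z : loc) : Prop := RegionOk {
  region_balanced : forall i b b',
    region_level P x z i b -> region_level P x z i b' ->
    size (body P b) = size (body P b');
  region_succs : forall i b c, region_level P x z i b -> edge P b c ->
    region_level P x z i.+1 c \/
    (c = z /\ forall b', ~ region_level P x z i.+1 b');
  region_single_entry : forall b c, in_region P x z b -> edge P c b ->
    c = x \/ in_region P x z c;
  region_not_fun_entry : forall b, in_region P x z b -> ~ is_entry P b;
  region_single_exit : forall b c, in_region P x z b -> edge P b c ->
    in_region P x z c \/ c = z }.

Record fun_pair_ok (A : isa) (P : sprog A) (f f' : loc) : Prop := FunPairOk {
  fun_last_ret : forall g i b, g \in [:: f; f'] -> fun_level P g i b ->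
    (forall j b', i < j -> ~ fun_level P g j b') -> is_ret (term P b);
  fun_balanced : forall i b b',
    fun_level P f i b \/ fun_level P f' i b ->
    fun_level P f i b' \/ fun_level P f' i b' ->
    size (body P b) = size (body P b');
  fun_succs : forall g i b c, g \in [:: f; f'] -> fun_level P g i b ->
    edge P b c -> fun_level P g i.+1 c }.

Definition s_init (A : isa) (P : sprog A) (c : sconf A) : Prop :=
  s_pc c = s_entry P /\ s_ret c = [::].

(* The program terminates when its main function returns; this is not
   considered as being stuck. *)
Definition s_final (A : isa) (P : sprog A) (c : sconf A) : Prop :=
  s_code P (s_pc c) = Some SRet /\ s_ret c = [::].

Definition safe (M : machine) (P : sprog M) : Prop :=
  forall c0 n o c, s_init P c0 ->
  nsteps (sstep (s_code P)) (fun=> tt) n c0 o c ->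
  s_final P c \/ exists c', sstep (s_code P) c c'.

Record wf_source (M : machine) (P : sprog M) : Prop := WfSource {
  source_cfg : wf_cfg P;
  source_entered : entered_at_entry P;
  source_regions : forall x z, sec_region P x z -> region_ok P x z;
  source_pairs : forall f f', seccall_pair P f f' -> fun_pair_ok P f f';
  source_safe : safe P }.

(** * Folding *)

(* The choices left open by the folding: where the code is placed in memory
   and how blocks are indexed within a level.
   - [addr b] is the location of the unfolded block [b];
   - [pair_addr f f'] is the entry label of [f] folded with its dummy [f'];
   - [rlevels x], [rexit x]: the levels (from the entry block on) and the exit
     block of the region of the secret-dependent branch that ends block [x];
   - [flevels f f']: the union of the level structures of [f] and [f']. *)
Record layout := Layout {
  addr : loc -> loc;
  pair_addr : loc -> loc -> loc;
  rlevels : loc -> seq (seq loc);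
  rexit : loc -> loc;
  flevels : loc -> loc -> seq (seq loc) }.

Definition copy_instr (A : isa) (lay : layout) (i : sinstr A) : tinstr A :=
  match i with
  | SBasic b => TBasic b
  | SBr e lt lf | SSecBr e lt lf => TBr e (addr lay lt) (addr lay lf)
  | SCall l => TCall (addr lay l)
  | SSecCall b l l' => TLoCall b (pair_addr lay l l')
  | SRet => TRet
  end.

(* Rewriting with respect to the next level [N]. *)
Definition fold_instr (A : isa) (lay : layout) (N : seq loc) (i : sinstr A) :
    tinstr A :=
  match i with
  | SBr e lt lf | SSecBr e lt lf => TLoBr e (index lt N) (index lf N) (size N)
  | _ => copy_instr lay i
  end.

(* The instruction at j * |L| + i is the j-th one of the i-th block of [L]. *)
Definition fold_level (A : isa) (P : sprog A) (lay : layout) (N L : seq loc) :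
    seq (tinstr A) :=
  let n := size L in
  mkseq
    (fun k => fold_instr lay N (nth SRet (body P (nth 0 L (k %% n))) (k %/ n)))
    (size (body P (head 0 L)) * n).

(* [last_next] is the level that comes after the last one. *)
Fixpoint fold_levels (A : isa) (P : sprog A) (lay : layout)
    (last_next : seq loc) (Ls : seq (seq loc)) : seq (tinstr A) :=
  if Ls is L :: Ls' then
    fold_level P lay (head last_next Ls') L ++ fold_levels P lay last_next Ls'
  else [::].

(* [Ls] lists the blocks of each level, given as a predicate. *)
Definition enumerates (Q : nat -> loc -> Prop) (Ls : seq (seq loc)) : Prop :=
  [/\ forall i b, b \in nth [::] Ls i <-> Q i b,
      all uniq Ls
    & [::] \notin Ls].

Definition kept (A : isa) (P : sprog A) (f : func A) : Prop :=
  [\/ called P (f_entry f),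
      f_entry f = s_entry P
    | forall g, ~ seccall_pair P (f_entry f) g /\
                ~ seccall_pair P g (f_entry f)].

Definition toplevel (A : isa) (P : sprog A) (b : loc) : Prop :=
  forall x z, sec_region P x z -> ~ in_region P x z b.

(* The contiguous pieces of code of the folded program: a function folded with
   its dummy, an outermost region (given by its entry block, and without its
   exit block), or a block outside of any region. *)
Inductive piece := FoldedFun of loc & loc | FoldedRegion of loc | Copied of loc.

Definition has_piece (A : isa) (P : sprog A) (u : piece) : Prop :=
  match u with
  | FoldedFun f f' => seccall_pair P f f'
  | FoldedRegion b | Copied b =>
      [/\ exists f, [/\ List.In f (s_funs P), kept P f & b \in labels f],
          toplevel P b
        & is_secbr (term P b) <-> u = FoldedRegion b]
  end.

Definition piece_addr (lay : layout) (u : piece) : loc :=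
  match u with
  | FoldedFun f f' => pair_addr lay f f'
  | FoldedRegion b | Copied b => addr lay b
  end.

Definition piece_code (A : isa) (P : sprog A) (lay : layout) (u : piece) :
    seq (tinstr A) :=
  match u with
  | FoldedFun f f' => fold_levels P lay [::] (flevels lay f f')
  | FoldedRegion x => fold_levels P lay [:: rexit lay x] (rlevels lay x)
  | Copied b => [seq copy_instr lay i | i <- body P b]
  end.

Record valid_layout (A : isa) (P : sprog A) (lay : layout) : Prop :=
  ValidLayout {
  layout_pair : forall f f', has_piece P (FoldedFun f f') ->
    enumerates (fun i b => fun_level P f i b \/ fun_level P f' i b)
      (flevels lay f f') /\
    head [::] (flevels lay f f') = [:: f; f'];
  layout_region : forall x, has_piece P (FoldedRegion x) ->
    [/\ sec_region P x (rexit lay x),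
        enumerates (region_level P x (rexit lay x)) (rlevels lay x)
      & addr lay (rexit lay x) =
        addr lay x + size (piece_code P lay (FoldedRegion x))];
  layout_disjoint : forall u v, has_piece P u -> has_piece P v -> u <> v ->
    piece_addr lay u + size (piece_code P lay u) <= piece_addr lay v \/
    piece_addr lay v + size (piece_code P lay v) <= piece_addr lay u }.

(* [folding P Q]: Q is the folding of P, for some layout. *)
Definition folding (A : isa) (P : sprog A) (Q : tprog A) : Prop :=
  exists2 lay, valid_layout P lay &
    t_entry Q = addr lay (s_entry P) /\
    forall l i, t_code Q l = Some i <->
      exists2 u, has_piece P u &
        code_at (piece_addr lay u, piece_code P lay u) l = Some i.

(** * Security *)

Definition t_init (A : isa) (Q : tprog A) (c : tconf A) : Prop :=
  [/\ t_pc c = t_entry Q, t_ret c = [::] & t_ctx c = [:: (1, 0)]].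

Definition s_low (M : machine) (c c' : sconf M) : Prop :=
  low_eq (s_mem c) (s_regs c) (s_mem c') (s_regs c').

Definition t_low (M : machine) (c c' : tconf M) : Prop :=
  low_eq (t_mem c) (t_regs c) (t_mem c') (t_regs c').

Definition weak_ONI (M : machine) (K : leakage M) (P : sprog M) : Prop :=
  ONI (sstep (s_code P)) (sobs_weak K (s_code P)) (s_init P) (@s_low M).

Definition strong_ONI (M : machine) (K : leakage M) (Q : tprog M) : Prop :=
  ONI (tstep (t_code Q)) (tobs_strong K (t_code Q)) (t_init Q) (@t_low M).

(* Main.v *)
Require Import Defs.
From mathcomp Require Import all_boot zify.
From Stdlib Require List.

Set Implicit Arguments.
Unset Strict Implicit.
Unset Printing Implicit Defensive.

(** Folding moves instructions but neither adds nor removes any, so that [P] and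
    its folding run in lockstep: a position of the folded program, given by a
    piece, a level, a row and an offset, determines both program counters and
    the Libra context. Two runs of [P] with equal weak observations stay in the
    same slices once folded, at possibly different offsets: observed kinds agree
    within a slice, the blocks of a level are equally long, all the successors
    of a level are in the next one, and the branches and calls that are not
    folded leak where they go. Hence the strong observations agree too. The
    delicate point is that the exit block of an outermost region starts a piece,
    that is, lies in no other region; this follows from postdomination. *)

(** * Blocks and their code *)

Lemma onth_nth_lt (T : Type) (x0 : T) (s : seq T) i :
  i < size s -> onth s i = Some (nth x0 s i).
Proof. by move=> lti; rewrite onthE (nth_map x0). Qed.

Definition disjoint_code (I : Type) (b c : loc * seq I) : bool :=
  (b.1 + size b.2 <= c.1) || (c.1 + size c.2 <= b.1).

(** [pairwise] separates entries at distinct positions, so an overlap forces a single position.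
    Membership is [List.In] because instructions carry no decidable equality. *)
Lemma in_overlap (I : Type) (bs : seq (loc * seq I)) b c :
  pairwise (@disjoint_code I) bs -> List.In b bs -> List.In c bs ->
  ~~ disjoint_code b c -> b = c.
Proof.
have all_in (s : seq (loc * seq I)) x y :
    all (disjoint_code x) s -> List.In y s -> disjoint_code x y.
  elim: s => //= z s IHs /andP[xz xs] [<- // | ys]; exact: IHs.
elim: bs => //= a bs IHbs /andP[aP bsP] [<- | bin] [<- | cin] // nov.
- by rewrite (all_in _ _ _ aP cin) in nov.
- by move: nov (all_in _ _ _ aP bin); rewrite /disjoint_code orbC => /negbTE->.
- exact: IHbs.
Qed.

Lemma fetch_in (I : Type) (bs : seq (loc * seq I)) b j :
  pairwise (@disjoint_code I) bs -> List.In b bs -> j < size b.2 ->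
  fetch bs (b.1 + j) = onth b.2 j.
Proof.
elim: bs => //= a bs IHbs /andP[aP bsP] bin ltj.
have bab : List.In b (a :: bs) by [].
case: bin => [-> | bin]; first rewrite /code_at leq_addr addKn.
  by case: (onth b.2 j) (onthTE b.2 j) => //; rewrite ltj.
(* [fetch] takes the first hit; an earlier block answering at this address overlaps [b], so it is
   [b]. *)
case E: (code_at a (b.1 + j)) => [i|]; last exact: IHbs.
move: E; rewrite /code_at; case: leqP => // le_a E.
have lta: b.1 + j - a.1 < size a.2 by rewrite -onthTE E.
have eqab : a = b.
  apply: (@in_overlap _ (a :: bs)) => //=; [by rewrite aP | by left |].
  by rewrite /disjoint_code; lia.
by rewrite -E eqab addKn.
Qed.

Section Cfg.

Context (A : isa) (P : sprog A) (wfP : wf_cfg P).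

Definition is_block (l : loc) : Prop :=
  exists2 f, List.In f (s_funs P) & l \in labels f.

Lemma in_blocks f b :
  List.In f (s_funs P) -> List.In b (f_blocks f) -> List.In b (blocks P).
Proof.
rewrite /blocks; elim: (s_funs P) => //= g fs IHfs [-> | fin] bin.
  by apply/List.in_or_app; left.
by apply/List.in_or_app; right; apply: IHfs.
Qed.

Lemma in_labels (f : func A) l :
  l \in labels f -> exists s, List.In (l, s) (f_blocks f).
Proof.
rewrite /labels; elim: (f_blocks f) => //= -[l' s] bs IHbs.
rewrite inE => /orP[/eqP-> | /IHbs[s' ?]]; first by exists s; left.
by exists s'; right.
Qed.

Lemma wf_body_size (s : seq (sinstr A)) : wf_body s -> 0 < size s.
Proof. by case=> s' [t [-> _ _]]; rewrite size_rcons. Qed.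

(** Bodies are nonempty, so two blocks with the same label overlap and coincide: a label identifies
    its block. *)
Lemma body_in b : List.In b (blocks P) -> body P b.1 = b.2.
Proof.
move=> bin.
have uniq_b c : List.In c (blocks P) -> c.1 = b.1 -> c = b.
  move=> cin eq1; apply: (in_overlap (wf_disjoint wfP) cin bin).
  rewrite /disjoint_code eq1.
  by have := wf_body_size (wf_blocks wfP bin);
     have := wf_body_size (wf_blocks wfP cin); lia.
rewrite /body; suff -> : ohead [seq c <- blocks P | c.1 == b.1] = Some b by [].
elim: (blocks P) bin uniq_b => //= c bs IHbs bin uniq_b.
case: eqP => [eq1 | neq1] /=; first by rewrite (uniq_b c) //; left.
by apply: IHbs => [|d din]; [case: bin neq1 => [->|] | apply: uniq_b; right].
Qed.

Lemma is_blockP l : is_block l -> List.In (l, body P l) (blocks P).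
Proof.
by case=> f fin /in_labels[s /(in_blocks fin) sin]; rewrite (body_in sin).
Qed.

Lemma wf_body_block l : is_block l -> wf_body (body P l).
Proof. by move/is_blockP/(wf_blocks wfP). Qed.

Lemma body_gt0 l : is_block l -> 0 < size (body P l).
Proof. by move/wf_body_block/wf_body_size. Qed.

Lemma s_code_block l j : is_block l -> j < size (body P l) ->
  s_code P (l + j) = Some (nth SRet (body P l) j).
Proof.
move=> /is_blockP lin ltj; rewrite -onth_nth_lt //.
exact: (fetch_in (wf_disjoint wfP) lin).
Qed.

Lemma is_term_last l j : is_block l -> j < size (body P l) ->
  is_term (nth SRet (body P l) j) ->
  nth SRet (body P l) j = term P l /\ j.+1 = size (body P l).
Proof.
rewrite /term => /wf_body_block[s [t [-> tP sP]]].
rewrite size_rcons last_rcons nth_rcons ltnS leq_eqVlt.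
case: ltngtP => //= [ltj _ | -> //].
by move/(has_nthP SRet): sP => sP jP; case: sP; exists j.
Qed.

Lemma not_term_last l j : is_block l -> j < size (body P l) ->
  ~~ is_term (nth SRet (body P l) j) -> j.+1 < size (body P l).
Proof.
move=> /wf_body_block[s [t [-> tP sP]]].
rewrite size_rcons nth_rcons !ltnS leq_eqVlt => /predU1P[-> | //].
by rewrite ltnn eqxx tP.
Qed.

(** A shared label would give two overlapping entries at distinct positions of [blocks P]. Positions
    are compared, so even a block listed identically in both functions is excluded. *)
Lemma func_unique f g l : List.In f (s_funs P) -> List.In g (s_funs P) ->
  l \in labels f -> l \in labels g -> f = g.
Proof.
move=> fin gin /in_labels[s lf] /in_labels[s' lg].
have [sP s'P] : 0 < size s /\ 0 < size s'.
  by split; apply: wf_body_size;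
     [apply: (wf_blocks wfP (in_blocks fin lf))
     | apply: (wf_blocks wfP (in_blocks gin lg))].
move: (wf_disjoint wfP) fin gin; rewrite /blocks.
have sep (xs ys : seq (loc * seq (sinstr A))) :
    allrel (@disjoint_code _) xs ys -> List.In (l, s) xs ->
    ~ List.In (l, s') ys.
  move=> xys xin yin.
  have : pairwise (@disjoint_code _) [:: (l, s); (l, s')].
    rewrite /= !andbT; elim: xs xys xin => //= x xs IHxs.
    rewrite allrel_consl => /andP[xP xsP] [xE | xin]; last exact: IHxs.
    elim: ys {IHxs xsP} xP yin => //= y ys IHys /andP[yP ysP] [yE | yin].
      by rewrite -xE -yE.
    exact: IHys.
  by rewrite /= /disjoint_code /=; lia.
have inb h x (fs : seq (func A)) : List.In h fs -> List.In x (f_blocks h) ->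
    List.In x (flatten [seq f_blocks f0 | f0 <- fs]).
  by elim: fs => //= k ks IH [->|hin] xin; apply/List.in_or_app;
     [left | right; apply: IH].
have disjC : symmetric (@disjoint_code (sinstr A)).
  by move=> x y; rewrite /disjoint_code orbC.
elim: (s_funs P) => //= h fs IHfs; rewrite pairwise_cat.
case/and3P=> hP _ fsP [hf | fin] [hg | gin].
- by rewrite -hf.
- by case: (sep _ _ hP); [rewrite hf | apply: inb gin lg].
- case: (sep (flatten [seq f_blocks f | f <- fs]) (f_blocks h)).
  + by rewrite allrelC; apply: etrans hP; apply: eq_allrel => x y; apply: disjC.
  + exact: inb fin lf.
  + by rewrite hg.
- exact: IHfs.
Qed.

Lemma path_labels f x p : List.In f (s_funs P) -> x \in labels f ->
  path (edge P) x p -> last x p \in labels f.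
Proof.
move=> fin; elim: p x => //= y p IHp x xf /andP[xy yp].
exact: IHp (wf_succs wfP fin xf xy) yp.
Qed.

End Cfg.

(** * Regions and their exits *)

Section Region.

Context (A : isa) (P : sprog A).

Lemma region_level_distance x z i b :
  region_level P x z i b -> distance P x b i.
Proof.
case: i => [-> /= | i [] //]; by split=> [|p _ _ //]; exists [::].
Qed.

Lemma exit_notin_region x z : ~ in_region P x z z.
Proof. by case=> p [q [_]]; rewrite mem_cat inE eqxx orbT. Qed.

(** By [region_succs] each edge that avoids the exit raises the level by exactly one. Hence all
    paths of the region to a given block have the same length. *)
Lemma region_level_path x z i b p : region_ok P x z ->
  region_level P x z i b -> path (edge P) b p -> z \notin p ->
  region_level P x z (i + size p) (last b p).
Proof.
move=> ok; elim: p i b => [|c p IHp] i b bi /=; first by rewrite addn0.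
case/andP=> bc cp; rewrite inE negb_or => /andP[zc zp].
case: (region_succs ok bi bc) => [ci | [cz _]]; last by rewrite cz eqxx in zc.
by rewrite -addSnnS; apply: IHp.
Qed.

Lemma shortest_path x y d : x <> y -> distance P x y d ->
  exists p, [/\ path (edge P) x (rcons p y), y \notin x :: p & d = (size p).+1].
Proof.
move=> neq [[p [+ + +]] min]; case/lastP: p => [//|p y' xp].
rewrite last_rcons size_rcons => y'y dE; subst y' d; exists p; split=> //.
rewrite inE; apply/norP; split; first by apply/eqP => /esym.
(* An earlier visit to [y] would cut the path short, against minimality. *)
apply/negP => yp; case/splitPr: yp xp min => p1 p2.
rewrite rcons_cat cat_path /= => /and3P[xp1 p1y _] min.
have := min (rcons p1 y); rewrite rcons_path xp1 p1y last_rcons.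
by move=> /(_ isT erefl); rewrite size_cat !size_rcons /=; lia.
Qed.

(* Otherwise [z] would be in a level of the region of [x'], hence strictly
   closer to [x'] than [z'], although it postdominates [x']. *)
Lemma exit_notin_nested_region f x z x' z' p : wf_cfg P ->
  List.In f (s_funs P) -> x \in labels f -> ipostdom P f z x ->
  path (edge P) x p -> z \notin x :: p -> last x p = x' ->
  sec_region P x' z' -> region_ok P x' z' -> ~ in_region P x' z' z.
Proof.
move=> wfP fin xf [_ [zf zpd] _] xp zp px' [f' [f'in x'f' _ pd']] ok zin.
have ff' : f' = f.
  by apply: (func_unique wfP f'in fin x'f'); rewrite -px';
     apply: path_labels xp.
case: pd' => z'x' _ [d' dz' min]; subst f'.
have x'z : z <> x'.
  by move=> E; rewrite lastI mem_rcons inE px' E eqxx in zp.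
(* The path [p] reaches [x'] without meeting [z], so the rest of any path to the function's exit
   must meet [z]. *)
have zpd' : postdominates P f z x'.
  split=> // q x'q qE.
  have := zpd (p ++ q); rewrite cat_path last_cat px' xp => /(_ x'q qE).
  rewrite inE mem_cat; move: zp; rewrite !inE => /norP[/negbTE-> /negbTE->] /=.
  by move->; rewrite orbT.
have [q [x'q z'q zq]] : exists q, [/\ path (edge P) x' q, z' \notin q
    & last x' q = z].
  case: zin => q [r []]; rewrite -!cat_rcons cat_path mem_cat negb_or.
  case/andP=> qz _ /andP[z'q _].
  by exists (rcons q z); rewrite last_rcons.
(* So [z] has level [size q]; the immediate postdominator [z'] is no farther from [x'] than [z],
   which gives [d' <= size q]. *)
have /= zk := region_level_path ok (erefl : region_level P x' z' 0 x') x'q z'q.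
rewrite add0n zq in zk.
have d'k := min _ _ x'z zpd' (region_level_distance zk).
have [r [x'r z'r d'r]] := shortest_path (nesym z'x') dz'.
move: x'r; rewrite rcons_path => /andP[x'r rz'].
have {}z'r : z' \notin r by move: z'r; rewrite inE => /norP[].
(* A shortest path to [z'] leaves the region from level [d' - 1], which forces level [d'] to be
   empty. *)
have /= rk := region_level_path ok (erefl : region_level P x' z' 0 x') x'r z'r.
case: (region_succs ok rk rz') => [[bad _] | [_ nolev]].
  exact: exit_notin_region bad.
rewrite add0n -d'r in nolev.
(* Yet the path [q], of length at least [d'], puts a block in level [d']. *)
have := nolev (last x' (take d' q)).
have qd : q = take d' q ++ drop d' q by rewrite cat_take_drop.
move: x'q z'q; rewrite {1 2}qd cat_path mem_cat negb_or.
case/andP=> tq _ /andP[z't _]; apply.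
have /= := region_level_path ok (erefl : region_level P x' z' 0 x') tq z't.
by rewrite add0n size_takel.
Qed.

(** Going backwards along the path, single entry keeps every predecessor in the region until its
    entry block is met. *)
Lemma region_backward x z y w p : region_ok P x z ->
  path (edge P) y (rcons p w) -> in_region P x z w ->
  in_region P x z y \/ x \in y :: p.
Proof.
move=> ok; elim/last_ind: p w => [|p v IHp] w.
  rewrite /= andbT => yw win; case: (region_single_entry ok win yw).
    by move=> ->; right; rewrite inE.
  by left.
rewrite rcons_path last_rcons => /andP[yv vw] win.
case: (region_single_entry ok win vw) => [<-|vin].
  by right; rewrite inE mem_rcons inE eqxx orbT.
case: (IHp _ yv vin) => [|xin]; [by left | right].
by rewrite inE mem_rcons !inE orbCA -in_cons xin orbT.
Qed.

(** If [z] were inside another region, going back from [z] to [x] would stay in it or meet its entry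
    block. The former contradicts that [x] is outermost, the latter makes that region start before
    [z], the case excluded above. *)
Lemma toplevel_exit x z : wf_cfg P ->
  (forall x z, sec_region P x z -> region_ok P x z) ->
  toplevel P x -> sec_region P x z -> toplevel P z.
Proof.
move=> wfP regs xtop [f [fin xf _ pd]] x' z' sx' zin.
have [zx _ [d dz _]] := pd.
have [p [xp zp _]] := shortest_path (nesym zx) dz.
have ok' := regs _ _ sx'.
case: (region_backward ok' xp zin) => [|x'p]; first exact: xtop.
have [p1 [p2 [pE p1x']]] : exists p1 p2, p = p1 ++ p2 /\ last x p1 = x'.
  by case/splitPl: x'p => p1 p2 E; exists p1, p2.
move: xp zp; rewrite pE rcons_cat cat_path -cat_cons mem_cat negb_or.
case/andP=> xp1 _ /andP[zp1 _].
exact: (exit_notin_nested_region wfP fin xf pd xp1 zp1 p1x' sx' ok').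
Qed.

(** A region is entered only from its entry block, and that block ends in a secret-dependent
    branch. *)
Lemma toplevel_succ b c :
  (forall x z, sec_region P x z -> region_ok P x z) ->
  toplevel P b -> ~~ is_secbr (term P b) -> edge P b c -> toplevel P c.
Proof.
move=> regs btop bsec bc x z sx cin.
case: (region_single_entry (regs _ _ sx) cin bc) => [bx|]; last exact: btop sx.
by case: sx => f [_ _]; rewrite -bx (negbTE bsec).
Qed.

Lemma toplevel_entry l :
  (forall x z, sec_region P x z -> region_ok P x z) ->
  is_entry P l -> toplevel P l.
Proof.
by move=> regs lentry x z sx /(region_not_fun_entry (regs _ _ sx)).
Qed.

End Region.

(** * Pieces of the folded program *)

Section Fold.

Context (M : machine) (P : sprog M) (lay : layout).

Definition level_size (L : seq loc) : nat := size (body P (head 0 L)) * size L.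

Definition level_start (Ls : seq (seq loc)) (i : nat) : nat :=
  sumn [seq level_size L | L <- take i Ls].

Lemma size_fold_level N L : size (fold_level P lay N L) = level_size L.
Proof. by rewrite size_mkseq. Qed.

Lemma size_fold_levels last_next Ls :
  size (fold_levels P lay last_next Ls) = level_start Ls (size Ls).
Proof.
rewrite /level_start take_size; elim: Ls => //= L Ls IHLs.
by rewrite size_cat size_fold_level IHLs.
Qed.

Lemma level_startS Ls i : i < size Ls ->
  level_start Ls i.+1 = level_start Ls i + level_size (nth [::] Ls i).
Proof.
by move=> lti; rewrite /level_start (take_nth [::]) // -cats1 map_cat sumn_cat
  /= addn0.
Qed.

Lemma onth_fold_level N L j k : k < size L -> j < size (body P (head 0 L)) ->
  onth (fold_level P lay N L) (j * size L + k) =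
  Some (fold_instr lay N (nth SRet (body P (nth 0 L k)) j)).
Proof.
move=> ltk ltj; have lt : j * size L + k < level_size L.
  apply: leq_trans (leq_mul ltj (leqnn (size L))).
  by rewrite mulSnr ltn_add2l.
rewrite (onth_nth_lt TRet) ?size_fold_level // nth_mkseq //.
rewrite modnMDl modn_small // divnMDl ?(leq_ltn_trans _ ltk) //.
by rewrite divn_small // addn0.
Qed.

Lemma onth_fold_levels last_next Ls i j k (L := nth [::] Ls i) :
  i < size Ls -> k < size L -> j < size (body P (head 0 L)) ->
  onth (fold_levels P lay last_next Ls) (level_start Ls i + (j * size L + k)) =
  Some (fold_instr lay (nth last_next Ls i.+1)
          (nth SRet (body P (nth 0 L k)) j)).
Proof.
rewrite /L {L}; elim: Ls i => //= L Ls IHLs [_ ltk ltj | i] /=.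
  rewrite /level_start take0 add0n onth_cat onth_fold_level //.
  rewrite size_fold_level nth0 ifT //.
  apply: leq_trans (leq_mul ltj (leqnn (size L))).
  by rewrite mulSnr ltn_add2l.
rewrite ltnS => lti ltk ltj; rewrite onth_cat size_fold_level.
rewrite /level_start /= -addnA ltnNge leq_addr addKn.
exact: IHLs.
Qed.

(** A copied block counts as one level of one block, so that all pieces share the same
    coordinates. *)
Definition levels (u : piece) : seq (seq loc) :=
  match u with
  | FoldedFun f f' => flevels lay f f'
  | FoldedRegion x => rlevels lay x
  | Copied b => [:: [:: b]]
  end.

Definition last_next (u : piece) : seq loc :=
  if u is FoldedRegion x then [:: rexit lay x] else [::].

Definition is_copied (u : piece) : bool :=
  if u is Copied _ then true else false.

Definition piece_of (l : loc) : piece :=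
  if is_secbr (term P l) then FoldedRegion l else Copied l.

(* The unfolded locations, which are the ones that branches outside of folded
   code and ordinary calls jump to. *)
Definition unfolded (l : loc) : Prop :=
  (exists f, [/\ List.In f (s_funs P), kept P f & l \in labels f]) /\
  toplevel P l.

Lemma has_piece_of l : unfolded l -> has_piece P (piece_of l).
Proof.
rewrite /piece_of => -[lf ltop]; case: ifP => E /=; split=> //; rewrite E //.
Qed.

Context (wfP : wf_source P) (layP : valid_layout P lay).

Let cfgP := source_cfg wfP.
Let entP := source_entered wfP.
Let regP := source_regions wfP.
Let pairP := source_pairs wfP.

Lemma distance_block f x y d : List.In f (s_funs P) -> x \in labels f ->
  distance P x y d -> y \in labels f.
Proof. by move=> fin xf [[p [xp <- _]] _]; apply: path_labels xp. Qed.

Lemma is_entry_block l : is_entry P l -> is_block P l.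
Proof. by case=> f fin <-; exists f => //; apply: (wf_entry cfgP). Qed.

Lemma unfolded_call l : called P l -> unfolded l.
Proof.
move=> lc; have le := entP.1 _ lc; split; last exact: toplevel_entry.
case: le => f fin fl; exists f; split=> //; last first.
  by rewrite -fl; apply: (wf_entry cfgP).
by rewrite /kept fl; apply: Or31.
Qed.

Lemma unfolded_main : unfolded (s_entry P).
Proof.
have le := wf_main cfgP; split; last exact: toplevel_entry.
case: le => f fin fl; exists f; split=> //; last first.
  by rewrite -fl; apply: (wf_entry cfgP).
exact: Or32.
Qed.

(** Level 0 is listed without repetition and its only member is [x]. A region is thus entered with
    the context [(1, 0)] of unfolded code. *)
Lemma region_level0 x : has_piece P (FoldedRegion x) ->
  nth [::] (rlevels lay x) 0 = [:: x].
Proof.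
case/(layout_region layP) => _ [lev /allP uniqL _] _.
have /= := lev 0; case: (rlevels lay x) uniqL => [|L Ls] /= uniqL lev0.
  by have := (lev0 x).2 erefl.
have := uniqL L; rewrite inE eqxx => /(_ isT).
have xL := (lev0 x).2 erefl.
case: L {uniqL} lev0 xL => // a [|b s] lev0 _.
  by move=> _; rewrite ((lev0 a).1 _) ?inE.
have ax : a = x by apply: (lev0 a).1; rewrite inE eqxx.
have bx : b = x by apply: (lev0 b).1; rewrite !inE eqxx orbT.
by rewrite ax bx /= inE eqxx.
Qed.

Lemma levels_start l : unfolded l -> nth [::] (levels (piece_of l)) 0 = [:: l].
Proof.
move/has_piece_of; rewrite /piece_of; case: ifP => // _.
exact: region_level0.
Qed.

Lemma levels_piece u i b : has_piece P u -> b \in nth [::] (levels u) i ->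
  is_block P b /\
  forall b', b' \in nth [::] (levels u) i -> size (body P b) = size (body P b').
Proof.
case: u => [f f' | x | c] /= hu.
- case: (layout_pair layP hu) => -[lev _ _] _ /lev bi.
  have fp := pairP hu; split; last first.
    by move=> b' /lev; apply: (fun_balanced fp bi).
  have [[g gin gf] [g' g'in gf']] := entP.2 _ _ hu.
  case: bi => [/(distance_block gin) | /(distance_block g'in)] h.
    by exists g => //; apply: h; rewrite -gf; apply: (wf_entry cfgP).
  by exists g' => //; apply: h; rewrite -gf'; apply: (wf_entry cfgP).
- have [sx [lev _ _] _] := layout_region layP hu.
  move=> /lev bi; split; last first.
    by move=> b' /lev; apply: (region_balanced (regP sx) bi).
  case: hu => -[f [fin _ xf]] _ _; exists f => //.
  exact: distance_block (region_level_distance bi).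
- case: hu => -[f [fin _ cf]] _ _; case: i => [|[]] //; rewrite inE => /eqP->.
  by split; [exists f | move=> b'; rewrite inE => /eqP->].
Qed.

Lemma levels_gt0 (Q : nat -> loc -> Prop) Ls i :
  enumerates Q Ls -> i < size Ls -> exists b, b \in nth [::] Ls i.
Proof.
case=> _ _ ne lti; case E: (nth [::] Ls i) => [|b s].
  by case/negP: ne; rewrite -E mem_nth.
by exists b; rewrite inE eqxx.
Qed.

(** Branches of a folded function never leave it, a region is left only for its exit block, and a
    copied block is always left. *)
Lemma piece_succ u i b c : has_piece P u -> b \in nth [::] (levels u) i ->
  edge P b c ->
  (i.+1 < size (levels u) /\ c \in nth [::] (levels u) i.+1) \/
  [/\ i.+1 = size (levels u), unfolded c
    & match u with
      | FoldedFun _ _ => False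
      | FoldedRegion x => c = rexit lay x
      | Copied _ => True
      end].
Proof.
(* The default level is empty, so membership bounds the index. *)
have inlt (Ls : seq (seq loc)) y k : y \in nth [::] Ls k -> k < size Ls.
  by case: ltnP => // le; rewrite nth_default.
case: u => [f f' | x | a] /= hu.
- case: (layout_pair layP hu) => -[lev _ _] _ /lev bi bc; left.
  have fp := pairP hu.
  suff cin : c \in nth [::] (flevels lay f f') i.+1.
    by split; first exact: inlt cin.
  apply/lev; case: bi => bi; [left | right].
    by apply: (fun_succs fp _ bi bc); rewrite !inE eqxx.
  by apply: (fun_succs fp _ bi bc); rewrite !inE eqxx orbT.
- have [sx enum _] := layout_region layP hu; have [lev _ _] := enum.
  move=> bL; have /lev bi := bL; have lti := inlt _ _ _ bL.
  move=> bc; case: (region_succs (regP sx) bi bc) => [/lev cin | [cz nolev]].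
    by left; split; first exact: inlt cin.
  right; split=> //.
    (* Listed levels are nonempty, so a region without level [i.+1] ends its list at level [i]. *)
    apply/eqP; rewrite eqn_leq lti leqNgt; apply/negP => lt.
    by have [b' /lev/nolev] := levels_gt0 enum lt.
  case: hu => -[f [fin fk xf]] xtop _; rewrite cz; split.
    exists f; split=> //; rewrite -cz; apply: (wf_succs cfgP) bc => //.
    exact: distance_block (region_level_distance bi).
  exact: toplevel_exit sx.
- case: i => [|[]] //; rewrite inE => /eqP-> ac; right; split=> //.
  case: hu => -[f [fin fk af]] atop asec; split.
    by exists f; split=> //; apply: (wf_succs cfgP) ac.
  by apply: toplevel_succ ac => //; apply/negP => /asec.
Qed.

(** * Positions in the folded program *)

(* The instruction in row [prow] of the block at index [pidx] of level [plev]
   of a piece; its index is its offset in the slice. *)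
Record pos := Pos { ppiece : piece; plev : nat; prow : nat; pidx : nat }.

Definition slice (p : pos) := (ppiece p, plev p, prow p).

Definition plevel (p : pos) : seq loc := nth [::] (levels (ppiece p)) (plev p).

Definition pos_block (p : pos) : loc := nth 0 (plevel p) (pidx p).

Definition pinstr (p : pos) : sinstr M :=
  nth SRet (body P (pos_block p)) (prow p).

Definition next_level (p : pos) : seq loc :=
  nth (last_next (ppiece p)) (levels (ppiece p)) (plev p).+1.

Definition ptinstr (p : pos) : tinstr M :=
  if ppiece p is Copied _ then copy_instr lay (pinstr p)
  else fold_instr lay (next_level p) (pinstr p).

Definition spc (p : pos) : loc := pos_block p + prow p.

Definition slice_addr (p : pos) : loc :=
  piece_addr lay (ppiece p) + level_start (levels (ppiece p)) (plev p)
  + prow p * size (plevel p).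

Definition tpc (p : pos) : loc := slice_addr p + pidx p.

Definition tctx (p : pos) : nat * nat := (size (plevel p), pidx p).

Definition valid (p : pos) : Prop :=
  [/\ has_piece P (ppiece p), pidx p < size (plevel p)
    & prow p < size (body P (pos_block p))].

Definition start (l : loc) : pos := Pos (piece_of l) 0 0 0.

Definition next_row (p : pos) : pos :=
  Pos (ppiece p) (plev p) (prow p).+1 (pidx p).

(** The position reached by a branch to [c]; outside the last level, the [index] is the offset that
    the rewritten branch carries. *)
Definition goto (p : pos) (c : loc) : pos :=
  if (plev p).+1 < size (levels (ppiece p)) then
    Pos (ppiece p) (plev p).+1 0 (index c (next_level p))
  else start c.

Definition callee (b : bool) (f f' : loc) : pos :=
  Pos (FoldedFun f f') 0 0 (if b then 0 else 1).

Lemma pos_block_in p : valid p -> pos_block p \in plevel p.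
Proof. by case=> _ ltk _; apply: mem_nth. Qed.

Lemma valid_plev p : valid p -> plev p < size (levels (ppiece p)).
Proof.
by move/pos_block_in; rewrite /plevel; case: ltnP => // le; rewrite nth_default.
Qed.

Lemma valid_block p : valid p -> is_block P (pos_block p).
Proof.
by move=> v; have [hu _ _] := v; case: (levels_piece hu (pos_block_in v)).
Qed.

Lemma valid_size p b : valid p -> b \in plevel p ->
  size (body P (pos_block p)) = size (body P b).
Proof.
move=> v; have [hu _ _] := v.
by case: (levels_piece hu (pos_block_in v)) => _; apply.
Qed.

Lemma head_plevel p : valid p -> head 0 (plevel p) \in plevel p.
Proof. by case=> _ + _; case: (plevel p) => //= a s; rewrite inE eqxx. Qed.

Lemma valid_s_code p : valid p -> s_code P (spc p) = Some (pinstr p).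
Proof.
by move=> v; apply: s_code_block => //; [apply: valid_block | case: v].
Qed.

Lemma valid_code_at p : valid p ->
  code_at (piece_addr lay (ppiece p), piece_code P lay (ppiece p)) (tpc p) =
  Some (ptinstr p).
Proof.
move=> v; rewrite /code_at /= /tpc /slice_addr -!addnA leq_addr addKn.
have lti := valid_plev v; have [_ ltk ltj] := v.
have ltj' := ltj; rewrite (valid_size v (head_plevel v)) in ltj'.
move: lti ltk ltj ltj'; rewrite /ptinstr /next_level /pinstr /pos_block /plevel.
case: p v => -[f f' | x | b] i j k _ /=.
- by move=> lti ltk _ ltj; apply: onth_fold_levels.
- by move=> lti ltk _ ltj; apply: onth_fold_levels.
case: i => [|i] //= _; case: k => [|k] //= _ ltj _; rewrite muln1 addn0.
by rewrite onth_map (onth_nth_lt SRet).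
Qed.

Lemma plevel_start l : unfolded l -> plevel (start l) = [:: l].
Proof. exact: levels_start. Qed.

Lemma pos_block_start l : unfolded l -> pos_block (start l) = l.
Proof. by move=> ul; rewrite /pos_block plevel_start. Qed.

Lemma valid_start l : unfolded l -> valid (start l).
Proof.
move=> ul; split; rewrite ?plevel_start ?pos_block_start //.
  exact: has_piece_of.
case: ul => -[f [fin _ lf]] _; apply: body_gt0 => //; by exists f.
Qed.

Lemma spc_start l : unfolded l -> spc (start l) = l.
Proof. by move=> ul; rewrite /spc pos_block_start // addn0. Qed.

Lemma tpc_start l : tpc (start l) = addr lay l.
Proof.
rewrite /tpc /slice_addr /= /level_start take0 !addn0 /piece_of.
by case: ifP.
Qed.

Lemma tctx_start l : unfolded l -> tctx (start l) = (1, 0).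
Proof. by move=> ul; rewrite /tctx plevel_start. Qed.

Lemma valid_next_row p : valid p -> ~~ is_term (pinstr p) -> valid (next_row p).
Proof.
move=> v nt; have [hu ltk ltj] := v; split=> //.
exact: (not_term_last cfgP (valid_block v) ltj nt).
Qed.

Lemma spc_next_row p : spc (next_row p) = (spc p).+1.
Proof. by rewrite /spc addnS. Qed.

Lemma tpc_next_row p : tpc (next_row p) = tpc p + size (plevel p).
Proof. by rewrite /tpc /slice_addr /plevel /= mulSn; lia. Qed.

Lemma callee_level0 f f' : seccall_pair P f f' ->
  nth [::] (flevels lay f f') 0 = [:: f; f'].
Proof. by move=> fp; have [_] := layout_pair layP fp; rewrite nth0. Qed.

Lemma pos_block_callee b f f' : seccall_pair P f f' ->
  pos_block (callee b f f') = if b then f else f'.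
Proof.
by move=> fp; rewrite /pos_block /plevel /= callee_level0 //; case: b.
Qed.

Lemma spc_callee b f f' : seccall_pair P f f' ->
  spc (callee b f f') = if b then f else f'.
Proof. by move=> fp; rewrite /spc pos_block_callee // addn0. Qed.

Lemma valid_callee b f f' : seccall_pair P f f' -> valid (callee b f f').
Proof.
move=> fp; have [fe fe'] := entP.2 _ _ fp; split=> //.
  by rewrite /plevel /= callee_level0 //; case: b.
rewrite pos_block_callee //; apply: body_gt0 => //.
by case: b; apply: is_entry_block.
Qed.

Lemma tpc_callee b f f' :
  tpc (callee b f f') = pair_addr lay f f' + (if b then 0 else 1).
Proof. by rewrite /tpc /slice_addr /= /level_start take0 !addn0. Qed.

Lemma tctx_callee b f f' : seccall_pair P f f' ->
  tctx (callee b f f') = (2, if b then 0 else 1).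
Proof. by move=> fp; rewrite /tctx /plevel /= callee_level0. Qed.

Lemma goto_cases p c : valid p -> edge P (pos_block p) c ->
  (goto p c = Pos (ppiece p) (plev p).+1 0 (index c (next_level p)) /\
   c \in plevel (goto p c) /\ next_level p = plevel (goto p c)) \/
  [/\ goto p c = start c, unfolded c, (plev p).+1 = size (levels (ppiece p))
    & match ppiece p with
      | FoldedFun _ _ => False
      | FoldedRegion x => c = rexit lay x
      | Copied _ => True
      end].
Proof.
move=> v; have [hu _ _] := v.
rewrite /goto.
case/(piece_succ hu (pos_block_in v)) => [[lt cin] | [eqs uc cx]].
  left; rewrite lt; split=> //; rewrite /plevel /=; split=> //.
  by rewrite /next_level; apply: set_nth_default.
by right; split=> //; rewrite eqs ltnn.
Qed.

Lemma pos_block_goto p c : valid p -> edge P (pos_block p) c ->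
  pos_block (goto p c) = c.
Proof.
move=> v; case/(goto_cases v) => [[gE [cin nE]] | [-> uc _ _]].
  by rewrite /pos_block [in pidx _]gE /= nE nth_index.
exact: pos_block_start.
Qed.

Lemma valid_goto p c : valid p -> edge P (pos_block p) c -> valid (goto p c).
Proof.
move=> v e; have bc := pos_block_goto v e.
case: (goto_cases v e) => [[gE [cin nE]] | [-> uc _ _]]; last first.
  exact: valid_start.
split; first by rewrite gE; case: v.
  by rewrite [in pidx _]gE /= nE index_mem.
rewrite bc [in prow _]gE /=; apply: body_gt0 => //.
have hu : has_piece P (ppiece (goto p c)) by rewrite gE; case: v.
by case: (levels_piece hu cin).
Qed.

Lemma goto_copied p c b : valid p -> edge P (pos_block p) c ->
  ppiece p = Copied b ->
  tpc (goto p c) = addr lay c /\ tctx (goto p c) = (1, 0).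
Proof.
move=> v /(goto_cases v) + pE; rewrite pE /= => -[[gE [cin _]] | [-> uc _ _]].
  by move: cin; rewrite gE /plevel /=; case: (plev p).
by rewrite tpc_start tctx_start.
Qed.

(** A terminator lies in the last row, so the slice after its own starts the next level. After the
    last level of a region this is the address of the exit block, by adjacency of the layout. *)
Lemma goto_folded p c : valid p -> edge P (pos_block p) c ->
  (prow p).+1 = size (body P (pos_block p)) ->
  ~~ is_copied (ppiece p) ->
  tpc (goto p c) = slice_addr p + size (plevel p) + index c (next_level p) /\
  tctx (goto p c) = (size (next_level p), index c (next_level p)).
Proof.
move=> v e eqj folded; have lti := valid_plev v; have [hu _ _] := v.
(* [level_size] counts rows on the head block, which is as long as the others of its level. *)
rewrite (valid_size v (head_plevel v)) in eqj.
have nextE : slice_addr p + size (plevel p) = piece_addr lay (ppiece p)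
    + level_start (levels (ppiece p)) (plev p).+1.
  rewrite level_startS // /level_size -/(plevel p) -eqj mulSn.
  by rewrite /slice_addr; lia.
rewrite nextE; case: (goto_cases v e) => [[gE [_ nE]] | [-> uc eqi cx]].
  rewrite /tctx -nE gE /=; split=> //.
  by rewrite /tpc /slice_addr /= addn0.
rewrite tpc_start tctx_start // /next_level eqi nth_default //.
case: (ppiece p) hu cx folded => // x hu -> _.
rewrite /= eqxx addn0; split=> //.
by have [_ _ ->] := layout_region layP hu; rewrite size_fold_levels.
Qed.


(** * Lockstep execution *)

Lemma nstepsS_inv (C O : Type) (step : C -> C -> Prop) (obs : C -> O) n c o c2 :
  nsteps step obs n.+1 c o c2 ->
  exists c1 o', [/\ step c c1, nsteps step obs n c1 o' c2 & o = obs c :: o'].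
Proof. by move=> run; inversion run; subst; do 2!eexists; split; eauto. Qed.

Context (K : leakage M) (Q : tprog M)
  (codeQ : forall l i, t_code Q l = Some i <->
     exists2 u, has_piece P u &
       code_at (piece_addr lay u, piece_code P lay u) l = Some i).

Definition sconf_of (m : Defs.mem M) (r : regs M) (p : pos) (ps : seq pos) :
    sconf M :=
  SConf m r (spc p) (map (spc) ps).

(** The list [ps] holds the pending return positions. A return site has the offset of its call, so
    its context is the one uncovered by [ret]. *)
Definition tconf_of (m : Defs.mem M) (r : regs M) (p : pos) (ps : seq pos) :
    tconf M :=
  TConf m r (tpc p) (map (tpc) ps) (map (tctx) (p :: ps)).

Definition data_step (i : sinstr M) (s s' : Defs.mem M * regs M) : Prop :=
  if i is SBasic b then exec b s s' else s' = s.

(** The current position is the head of the result; an empty result, from a return of the main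
    function, stands for the absence of a step. *)
Definition advance (r : regs M) (p : pos) (ps : seq pos) : seq pos :=
  match pinstr p with
  | SBasic _ => next_row p :: ps
  | SBr e lt lf | SSecBr e lt lf =>
      goto p (if eval r e != vzero M then lt else lf) :: ps
  | SCall l => [:: start l, next_row p & ps]
  | SSecCall b l l' => [:: callee b l l', next_row p & ps]
  | SRet => ps
  end.

Local Notation valids := (List.Forall (valid)).

Lemma pinstr_term p : valid p -> is_term (pinstr p) ->
  pinstr p = term P (pos_block p) /\
  (prow p).+1 = size (body P (pos_block p)).
Proof.
move=> v tP; have [_ _ ltj] := v.
exact: (is_term_last cfgP (valid_block v)).
Qed.

Lemma pinstr_edge p e lt lf (b : bool) : valid p ->
  pinstr p = SBr e lt lf \/ pinstr p = SSecBr e lt lf ->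
  edge P (pos_block p) (if b then lt else lf).
Proof.
move=> v iE; have [|tE _] := pinstr_term v; first by case: iE => ->.
rewrite /edge /succs -tE; case: iE => ->;
by case: b; rewrite !inE eqxx ?orbT.
Qed.

Lemma copied_not_secbr p b : valid p -> ppiece p = Copied b ->
  ~~ is_secbr (pinstr p).
Proof.
move=> v pE; apply/negP => sP.
have [|tE _] := pinstr_term v; first by case: (pinstr p) sP.
have [hu _ _] := v; move: hu (pos_block_in v); rewrite /plevel pE /=.
case=> _ _ [bsec _]; case: (plev p) => [|[]] //; rewrite inE => /eqP bE.
by move: sP; rewrite tE bE => /bsec.
Qed.

Lemma pinstr_call p l : valid p -> pinstr p = SCall l ->
  unfolded l.
Proof.
move=> v iE; apply: unfolded_call => //; exists (spc p).
by rewrite (valid_s_code v) iE.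
Qed.

Lemma pinstr_seccall p b l l' : valid p ->
  pinstr p = SSecCall b l l' -> seccall_pair P l l'.
Proof.
move=> v iE; exists (spc p), b.
by rewrite (valid_s_code v) iE.
Qed.

Lemma advance_valid r p ps : valids (p :: ps) -> valids (advance r p ps).
Proof.
move=> vps; have v := List.Forall_inv vps.
have vs := List.Forall_inv_tail vps.
rewrite /advance; case E: (pinstr p) => [b|e lt lf|l||e lt lf|b l l'].
- by constructor=> //; apply: valid_next_row; rewrite ?E.
- by constructor=> //; apply: valid_goto => //; apply: pinstr_edge; eauto.
- constructor; first by apply: valid_start => //; apply: pinstr_call E.
  by constructor=> //; apply: valid_next_row; rewrite ?E.
- by [].
- by constructor=> //; apply: valid_goto => //; apply: pinstr_edge; eauto.
- constructor; first by apply: valid_callee => //; apply: pinstr_seccall E.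
  by constructor=> //; apply: valid_next_row; rewrite ?E.
Qed.

Lemma t_code_valid p : valid p ->
  t_code Q (tpc p) = Some (ptinstr p).
Proof.
move=> v; apply/codeQ; exists (ppiece p); first by case: v.
exact: valid_code_at.
Qed.

Lemma spc_goto p e lt lf (b : bool) : valid p ->
  pinstr p = SBr e lt lf \/ pinstr p = SSecBr e lt lf ->
  spc (goto p (if b then lt else lf)) = if b then lt else lf.
Proof.
move=> v /(pinstr_edge b v) e'.
rewrite /spc (pos_block_goto v e') //.
by rewrite /goto; case: (_ < _); exact: addn0.
Qed.

Lemma sstep_advance m r p ps m' r' p' ps' : valids (p :: ps) ->
  data_step (pinstr p) (m, r) (m', r') -> advance r p ps = p' :: ps' ->
  sstep (s_code P) (sconf_of m r p ps) (sconf_of m' r' p' ps').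
Proof.
move=> vps; have v := List.Forall_inv vps.
have := valid_s_code v.
rewrite /advance /sconf_of.
case E: (pinstr p) => [b|e lt lf|l||e lt lf|b l l'] /= iE dE.
- by case=> <- <-; rewrite spc_next_row; apply: sstep_basic dE.
- case: dE => -> -> [<- <-]; rewrite (spc_goto _ v (or_introl E)).
  exact: sstep_br iE.
- case: dE => -> -> [<- <-] /=; rewrite spc_next_row spc_start //.
    exact: sstep_call iE.
  exact: pinstr_call E.
- by case: dE => -> -> -> /=; apply: sstep_ret.
- case: dE => -> -> [<- <-]; rewrite (spc_goto _ v (or_intror E)).
  exact: sstep_secbr iE.
- case: dE => -> -> [<- <-] /=; rewrite spc_next_row.
  rewrite spc_callee; last exact: pinstr_seccall E.
  exact: sstep_seccall iE.
Qed.

Lemma sstep_inv m r p ps c : valids (p :: ps) ->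
  sstep (s_code P) (sconf_of m r p ps) c ->
  exists m' r' p' ps', [/\ data_step (pinstr p) (m, r) (m', r'),
    advance r p ps = p' :: ps' & c = sconf_of m' r' p' ps'].
Proof.
move=> vps; have v := List.Forall_inv vps.
have := valid_s_code v.
rewrite /advance /sconf_of => iE st; inversion st; subst; clear st.
all: match goal with H : s_code P (_) = Some ?i |- _ =>
  lazymatch i with pinstr _ => fail | _ => move: H; rewrite iE => -[E] end end.
all: rewrite E /=.
- by exists m', r', (next_row p), ps; rewrite spc_next_row.
- do 4!eexists; split; [by []|by []|].
  by rewrite /sconf_of (spc_goto _ v (or_introl E)).
- do 4!eexists; split; [by []|by []|].
  by rewrite /sconf_of (spc_goto _ v (or_intror E)).
- do 4!eexists; split; [by []|by []|rewrite /sconf_of /= spc_next_row].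
  by rewrite spc_start //; apply: pinstr_call E.
- do 4!eexists; split; [by []|by []|rewrite /sconf_of /= spc_next_row].
  by rewrite spc_callee //; apply: pinstr_seccall E.
- by case: ps vps H3 => // q qs _ [-> ->]; exists m, r, q, qs.
Qed.

Lemma ptinstr_copy p :
  ~~ is_term (pinstr p) \/ is_ret (pinstr p) ->
  ptinstr p = copy_instr lay (pinstr p).
Proof.
rewrite /ptinstr.
by case: (pinstr p) => [?|? ? ?|?||? ? ?|? ? ?] [] // _; case: (ppiece p).
Qed.

Lemma tctx_copied p b : valid p -> ppiece p = Copied b -> tctx p = (1, 0).
Proof.
case=> _ + _ pE; rewrite /tctx /plevel pE /=.
by case: (plev p) => [|[]] //=; case: (pidx p).
Qed.

Lemma tstep_branch m r p ps e lt lf (b := eval r e != vzero M) : valid p ->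
  pinstr p = SBr e lt lf \/ pinstr p = SSecBr e lt lf ->
  tstep (t_code Q) (tconf_of m r p ps)
    (tconf_of m r (goto p (if b then lt else lf)) ps).
Proof.
move=> v iE; have e' := pinstr_edge b v iE.
have [|_ eqj] := pinstr_term v; first by case: iE => ->.
have tE := t_code_valid v; rewrite /tconf_of /=.
case E: (ppiece p) => [f f' | x | a].
1,2: have folded : ~~ is_copied (ppiece p) by rewrite E.
1,2: have tiE : ptinstr p = TLoBr e (index lt (next_level p))
       (index lf (next_level p)) (size (next_level p))
     by rewrite /ptinstr E; case: iE => ->.
1,2: rewrite tiE in tE; have [-> ->] := goto_folded v e' eqj folded.
(* [lo.br] first subtracts the offset, which recovers the address of the slice. *)
1,2: have -> : slice_addr p = tpc p - pidx p by rewrite addnK.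
1,2: apply: (tstep_lobr _ _ _ _ _ tE); by rewrite -/b; case: (b).
have tiE : ptinstr p = TBr e (addr lay lt) (addr lay lf).
  by rewrite /ptinstr E; case: iE => ->.
rewrite tiE in tE; have [-> ->] := goto_copied v e' E.
rewrite (tctx_copied v E).
have -> : addr lay (if b then lt else lf) =
          if b then addr lay lt else addr lay lf by case: (b).
exact: tstep_br tE.
Qed.

Lemma tstep_advance m r p ps m' r' p' ps' : valids (p :: ps) ->
  data_step (pinstr p) (m, r) (m', r') -> advance r p ps = p' :: ps' ->
  tstep (t_code Q) (tconf_of m r p ps) (tconf_of m' r' p' ps').
Proof.
move=> vps; have v := List.Forall_inv vps.
have := t_code_valid v; rewrite /advance.
case E: (pinstr p) => [b|e lt lf|l||e lt lf|b l l'] /= iE dE.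
- case=> <- <-; rewrite ptinstr_copy E in iE; last by left.
  by rewrite /tconf_of /= tpc_next_row; apply: tstep_basic dE.
- by case: dE => -> -> [<- <-]; apply: tstep_branch; last by left.
- case: dE => -> -> [<- <-]; rewrite ptinstr_copy E in iE; last by left.
  have ul := pinstr_call v E.
  rewrite /tconf_of /= tpc_next_row tpc_start tctx_start //.
  exact: tstep_call iE.
- case: dE => -> -> ->; rewrite ptinstr_copy E in iE; last by right.
  exact: tstep_ret iE.
- by case: dE => -> -> [<- <-]; apply: tstep_branch; last by right.
- case: dE => -> -> [<- <-]; rewrite ptinstr_copy E in iE; last by left.
  have fp := pinstr_seccall v E.
  rewrite /tconf_of /= tpc_next_row tpc_callee tctx_callee //.
  exact: tstep_locall iE _.
Qed.

Lemma tstep_det c c1 c2 :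
  tstep (t_code Q) c c1 -> tstep (t_code Q) c c2 -> c1 = c2.
Proof.
move=> st1 st2; inversion st1; subst; inversion st2; subst; clear st1 st2.
all: match goal with H : t_code Q _ = _, H' : t_code Q _ = _ |- _ =>
  move: H'; rewrite H; try discriminate end.
all: try by [].
all: try by case; intros; subst.
by case=> ?; subst; match goal with H : exec _ _ _, H' : exec _ _ _ |- _ =>
  case: (exec_det H H') => -> -> end.
Qed.

Lemma tstep_inv m r p ps c : valids (p :: ps) ->
  tstep (t_code Q) (tconf_of m r p ps) c ->
  exists m' r' p' ps', [/\ data_step (pinstr p) (m, r) (m', r'),
    advance r p ps = p' :: ps' & c = tconf_of m' r' p' ps'].
Proof.
move=> vps st; have v := List.Forall_inv vps.
(* By determinism the given step is the one built by [tstep_advance], so only its data have to be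
   found. *)
suff [m' [r' [p' [ps' [dE aE]]]]] : exists m' r' p' ps',
    data_step (pinstr p) (m, r) (m', r') /\ advance r p ps = p' :: ps'.
  exists m', r', p', ps'; split=> //.
  exact: tstep_det st (tstep_advance vps dE aE).
have iE := t_code_valid v; rewrite /advance.
case E: (pinstr p) => [b|e lt lf|l||e lt lf|b l l'] /=;
  try by do 4!eexists; split.
- rewrite ptinstr_copy E in iE; last by left.
  inversion st; subst;
    match goal with H : t_code Q _ = _ |- _ =>
      move: H; rewrite iE => -[] // end.
  by move=> ->; do 4!eexists; split; first eassumption.
- rewrite ptinstr_copy E in iE; last by right.
  case: ps vps st => [|q qs] _ st; last by do 4!eexists; split.
  by inversion st; subst;
    match goal with H : t_code Q _ = _ |- _ => move: H; rewrite iE end.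
Qed.

(** * Two runs in the same slices *)

Lemma copied_pinstr p q : valid p -> valid q -> slice p = slice q ->
  is_copied (ppiece p) -> pinstr p = pinstr q.
Proof.
have idx0 x : valid x -> is_copied (ppiece x) -> pidx x = 0.
  case=> _ + _; rewrite /plevel; case: (ppiece x) => //= a.
  by case: (plev x) => [|[]] //=; case: (pidx x).
move=> vp vq [uE iE jE] cp; have cq := cp; rewrite uE in cq.
by rewrite /pinstr /pos_block /plevel uE iE jE !idx0.
Qed.

Lemma slice_goto p q c c' : valid p -> valid q -> slice p = slice q ->
  edge P (pos_block p) c -> edge P (pos_block q) c' ->
  (is_copied (ppiece p) -> c = c') -> slice (goto p c) = slice (goto q c').
Proof.
move=> vp vq [uE iE _] ec ec' cc'.
rewrite /goto -uE -iE; case: ifP => lt //.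
have [hp _ _] := vp; have [hq _ _] := vq.
(* Both branches leave the piece: from a region they can only go to its exit block. *)
suff -> : c = c' by [].
case: (piece_succ hp (pos_block_in vp) ec) => [[] | [_ _ cx]].
  by rewrite lt.
case: (piece_succ hq (pos_block_in vq) ec') => [[] | [_ _ cx']].
  by rewrite -uE -iE lt.
rewrite -uE in cx'.
by case: (ppiece p) cx cx' cc' => // [x -> -> | b _ _ ->].
Qed.

Lemma skind_class i i' : lclass_of K (skind i) = lclass_of K (skind i') ->
  skind i = skind i' \/ exists b b', i = SBasic b /\ i' = SBasic b'.
Proof.
move=> eqK; have [fi | nfi] := boolP (alters_flow (skind i)).
  by left; apply: lclass_of_flow eqK.
have [fi' | nfi'] := boolP (alters_flow (skind i')).
  by left; symmetry; apply: lclass_of_flow fi' (esym eqK).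
right; case: i i' nfi nfi' {eqK} => [b|? ? ?|?||? ? ?|? ? ?] //.
case=> [b'|? ? ?|?||? ? ?|? ? ?] // _ _.
by exists b, b'.
Qed.

(** The weak observation fixes the kind of instruction, and whatever it hides changes only offsets.
    Pending return positions are compared too, since a [ret] resumes one of them. *)
Lemma advance_slice r r' p q ps qs : valid p -> valid q -> slice p = slice q ->
  map slice ps = map slice qs ->
  swobs K r (pinstr p) = swobs K r' (pinstr q) ->
  map slice (advance r p ps) = map slice (advance r' q qs).
Proof.
move=> vp vq pq psqs; rewrite /advance /swobs => -[eqK].
have rowE : slice (next_row p) = slice (next_row q).
  by case: pq => uE iE jE; rewrite /slice /= uE iE jE.
have cpq := copied_pinstr vp vq pq.
case: (skind_class eqK) => [eqk | [b [b' [-> ->]]] _]; last first.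
  by rewrite /= rowE psqs.
case Ep: (pinstr p) eqk => [b|e lt lf|l||e lt lf|b l l'];
  case Eq: (pinstr q) => [b'|e' lt' lf'|k||e' lt' lf'|b' k k'] //=.
- by rewrite rowE psqs.
(* The outcome matters only in a copied block, where both runs are at the same branch and leak the
   same outcome. *)
- move=> _ [/br_out_outcome outE]; rewrite psqs; congr cons.
  apply: slice_goto => //; try by apply: pinstr_edge; eauto.
  by move/cpq; rewrite Ep Eq => -[_ -> ->]; rewrite outE.
- by move=> _ [->]; rewrite rowE psqs.
(* The outcomes may differ here, but a copied block has no secret-dependent branch. *)
- move=> _ _; rewrite psqs; congr cons.
  apply: slice_goto => //; try by apply: pinstr_edge; eauto.
  case E: (ppiece p) => [||a] // _.
  by have := copied_not_secbr vp E; rewrite Ep.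
(* The leakage class reveals the function/dummy pair, hence the piece; the immediates only select
   the offset. *)
- by case=> -> -> _; rewrite rowE psqs.
Qed.

(** Folding turns branches into [lo.br], which exposes only its kind; the other instructions keep
    what they expose, up to the relocation of call targets and of pairs. *)
Lemma twobs_slice r r' p q : valid p -> valid q -> slice p = slice q ->
  swobs K r (pinstr p) = swobs K r' (pinstr q) ->
  twobs K r (ptinstr p) = twobs K r' (ptinstr q).
Proof.
move=> vp vq pq; have [uE _ _] := pq; rewrite /ptinstr -uE.
have nsp b := copied_not_secbr vp (b := b).
rewrite /twobs /swobs => -[eqK].
case: (skind_class eqK) => [eqk | [b [b' [Ep Eq]]]]; last first.
  move: eqK; rewrite Ep Eq /= => eqK atE.
  by case: (ppiece p) => *; rewrite /= eqK atE.
case Ep: (pinstr p) eqk => [b|e lt lf|l||e lt lf|b l l'];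
  case Eq: (pinstr q) => [b'|e' lt' lf'|k||e' lt' lf'|b' k k'] //=.
- by case=> -> atE; case: (ppiece p) => *; rewrite /= atE.
- by move=> _ [outE]; case: (ppiece p) => *; rewrite /= ?outE.
- by move=> _ [->]; case: (ppiece p).
- by case: (ppiece p).
- case E: (ppiece p) => [||a] //; have := nsp a E; by rewrite Ep.
- by case=> -> ->; case: (ppiece p).
Qed.

Lemma sobs_weakE m r p ps : valid p ->
  sobs_weak K (s_code P) (sconf_of m r p ps) = Some (swobs K r (pinstr p)).
Proof. by move=> v; rewrite /sobs_weak /= valid_s_code. Qed.

Lemma tobs_strongE m r p ps : valid p ->
  tobs_strong K (t_code Q) (tconf_of m r p ps) =
  Some (slice_addr p, twobs K r (ptinstr p)).
Proof. by move=> v; rewrite /tobs_strong /= t_code_valid //= /tpc addnK. Qed.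

Lemma slice_addr_slice p q : slice p = slice q -> slice_addr p = slice_addr q.
Proof. by case=> uE iE jE; rewrite /slice_addr /plevel uE iE jE. Qed.

Lemma data_step_det i s s1 s2 : data_step i s s1 -> data_step i s s2 -> s1 = s2.
Proof.
by case: i => [b|? ? ?|?||? ? ?|? ? ?] /=; first exact: exec_det;
   move=> -> ->.
Qed.

(** This supplies the source run to which the noninterference of [P] is applied. *)
Lemma nsteps_source n m r p ps o c : valids (p :: ps) ->
  nsteps (tstep (t_code Q)) (tobs_strong K (t_code Q)) n
    (tconf_of m r p ps) o c ->
  exists os s, nsteps (sstep (s_code P)) (sobs_weak K (s_code P)) n
    (sconf_of m r p ps) os s.
Proof.
elim: n m r p ps o => [|n IHn] m r p ps o vps run.
  by do 2!eexists; apply: nsteps0.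
have [c1 [o1 [st run' _]]] := nstepsS_inv run.
have [m' [r' [p' [ps' [dE aE cE]]]]] := tstep_inv vps st; subst.
have vps' : valids (p' :: ps') by rewrite -aE; apply: advance_valid.
have [os [s run_s]] := IHn _ _ _ _ _ vps' run'.
by do 2!eexists; apply: nstepsS (sstep_advance vps dE aE) run_s.
Qed.

(** The second target run is read off the second source run, with equality of all slices, current
    and pending, as the invariant. *)
Lemma nsteps_lockstep n m r p ps m' r' q qs o c os s s' :
  valids (p :: ps) -> valids (q :: qs) ->
  map slice (p :: ps) = map slice (q :: qs) ->
  nsteps (tstep (t_code Q)) (tobs_strong K (t_code Q)) n
    (tconf_of m r p ps) o c ->
  nsteps (sstep (s_code P)) (sobs_weak K (s_code P)) n
    (sconf_of m r p ps) os s ->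
  nsteps (sstep (s_code P)) (sobs_weak K (s_code P)) n
    (sconf_of m' r' q qs) os s' ->
  exists c', nsteps (tstep (t_code Q)) (tobs_strong K (t_code Q)) n
    (tconf_of m' r' q qs) o c'.
Proof.
elim: n m r p ps m' r' q qs o os => [|n IHn] m r p ps m' r' q qs o os.
  by move=> _ _ _ run _ _; inversion run; eexists; apply: nsteps0.
move=> vps vqs pqs run run_s run_s'.
have pq : slice p = slice q := congr1 (head (slice p)) pqs.
have psqs : map slice ps = map slice qs := congr1 behead pqs.
have [vp vq] := (List.Forall_inv vps, List.Forall_inv vqs).
have [c1 [o1 [st run1 ->]]] := nstepsS_inv run.
have [s1 [os1 [st_s run_s1 osE]]] := nstepsS_inv run_s.
have [s2 [os2 [st_s' run_s2 osE']]] := nstepsS_inv run_s'.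
move: osE' {run run_s run_s'}; rewrite osE => -[obsE] ?; subst.
have [m1 [r1 [p1 [ps1 [dE aE cE]]]]] := tstep_inv vps st; subst.
have [m2 [r2 [p2 [ps2 [dE2 aE2 cE2]]]]] := sstep_inv vps st_s; subst.
have [m3 [r3 [p3 [ps3 [dE3 aE3 cE3]]]]] := sstep_inv vqs st_s'; subst.
(* The first target run and the first source run make the same move. *)
move: (data_step_det dE dE2) aE2 => [? ?]; rewrite aE => -[? ?]; subst.
have vps1 : valids (p2 :: ps2) by rewrite -aE; apply: advance_valid.
have vqs1 : valids (p3 :: ps3) by rewrite -aE3; apply: advance_valid.
move: obsE; rewrite !sobs_weakE // => /Some_inj obsE.
have sl : map slice (p2 :: ps2) = map slice (p3 :: ps3).
  by rewrite -aE -aE3; exact: (advance_slice vp vq pq psqs obsE).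
have [c' run'] := IHn _ _ _ _ _ _ _ _ _ _ vps1 vqs1 sl run1 run_s1 run_s2.
exists c'; rewrite tobs_strongE // (slice_addr_slice pq).
rewrite (twobs_slice vp vq pq obsE) -(tobs_strongE m' r' qs vq).
exact: nstepsS (tstep_advance vqs dE3 aE3) run'.
Qed.

End Fold.

Theorem proposition5p2 (M : machine) (K : leakage M) (P : sprog M)
    (Q : tprog M) (hP : wf_source P) (hQ : folding P Q) :
  weak_ONI K P -> strong_ONI K Q.
Proof.
case: hQ => lay layP [entryQ codeQ] oni.
(* Both runs start at this one position, so their initial slices agree trivially. *)
have um := unfolded_main hP; pose p := start P (s_entry P).
have vp : List.Forall (valid P lay) [:: p].
  by constructor=> //; apply: valid_start.
have initE (c : tconf M) : t_init Q c ->
    c = tconf_of P lay (t_mem c) (t_regs c) p [::].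
  case: c => m r pc rho lam [/= -> -> ->].
  by rewrite /tconf_of /= tpc_start tctx_start // entryQ.
move=> c c' /initE-> /initE-> low n o cn run.
have [os [s run_s]] := nsteps_source hP layP codeQ vp run.
have sinit (d : tconf M) : s_init P (sconf_of lay (t_mem d) (t_regs d) p [::]).
  by split=> //=; rewrite spc_start.
have [s' [os' [run_s' osE]]] := oni _ _ (sinit c) (sinit c') low _ _ _ run_s.
rewrite -osE in run_s'.
have [cn' run'] := nsteps_lockstep hP layP codeQ vp vp erefl run run_s run_s'.
by exists cn', o.
Qed.
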